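(* Let $X$ be a scheme, and let $\mathrm{Irr}(X)$ be the set of its irreducible components. a) The following statements are equivalent: (i) $X$ is locally integral; (ii) $X$ is pointwise integral and $\mathrm{Irr}(X)$ is locally finite. b) The following statements are equivalent: (i) $X$ is integral; (ii) $X$ is nonempty, connected and locally integral; (iii) $X$ is nonempty, connected and pointwise integral and $\mathrm{Irr}(X)$ is locally finite.
   Context: A topological space is irreducible if the intersection of finitely many nonempty open subsets is nonempty (so irreducible spaces are nonempty), and locally irreducible if every point has an irreducible neighbourhood (equivalently, an irreducible open neighbourhood). A scheme is irreducible or locally irreducible if its underlying topological space is so. A commutative ring is irreducible if its spectrum is irreducible, equivalently if it has precisely one minimal prime ideal. A scheme $X$ is pointwise irreducible if the ring $\mathscr{O}_{X,x}$ is irreducible for every $x\in X$. A scheme is integral, locally integral, or pointwise integral if it is reduced and moreover irreducible, locally irreducible, or pointwise irreducible, respectively. $\mathrm{Irr}(X)$ is the set of $\subseteq$-maximal irreducible subsets of the underlying space of $X$; it is locally finite if every point of $X$ has a neighbourhood meeting only finitely many elements of $\mathrm{Irr}(X)$. The empty space is considered connected. *)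

(* Defs.v *)
From HB Require Import structures.
From mathcomp Require Import all_boot all_algebra.
From mathcomp Require Import mathcomp_extra boolp classical_sets functions.
From mathcomp Require Import cardinality topology.
From mathcomp Require Import ring.

Set Implicit Arguments.
Unset Strict Implicit.
Unset Printing Implicit Defensive.

Import GRing.Theory.
Local Open Scope classical_set_scope.
Local Open Scope ring_scope.
Local Open Scope quotient_scope.

(* Rings are commutative with unit, possibly zero (comPzRingType): the sections
   of a sheaf over the empty set form the zero ring.  The ideals of
   ring_quotient.v require a nonzero ambient ring, hence the definitions
   below. *)

Definition is_ideal (A : comPzRingType) (I : set A) : Prop :=
  [/\ I 0, forall a b, I a -> I b -> I (a + b) & forall a b, I b -> I (a * b)].

Definition prime_ideal (A : comPzRingType) (P : set A) : Prop :=
  [/\ is_ideal P, ~ P 1 & forall a b, P (a * b) -> P a \/ P b].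

Definition maximal_ideal (A : comPzRingType) (M : set A) : Prop :=
  [/\ is_ideal M, ~ M 1 &
      forall I : set A, is_ideal I -> ~ I 1 -> M `<=` I -> I = M].

Definition local_ring (A : comPzRingType) : Prop :=
  exists! M : set A, maximal_ideal M.

Definition reduced_ring (A : comPzRingType) : Prop :=
  forall (x : A) (n : nat), x ^+ n = 0 -> x = 0.

(* Ring operations on T satisfying the ring axioms up to an equivalence
   relation; both localizations and stalks are quotients of this kind. *)
Record setoid_ring : Type := SetoidRing {
  sr_sort : Type;
  sr_eqv : sr_sort -> sr_sort -> Prop;
  sr_zero : sr_sort;
  sr_one : sr_sort;
  sr_opp : sr_sort -> sr_sort;
  sr_add : sr_sort -> sr_sort -> sr_sort;
  sr_mul : sr_sort -> sr_sort -> sr_sort;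
  sr_refl : forall x, sr_eqv x x;
  sr_sym : forall x y, sr_eqv x y -> sr_eqv y x;
  sr_trans : forall x y z, sr_eqv x y -> sr_eqv y z -> sr_eqv x z;
  sr_opp_eqv : forall x y, sr_eqv x y -> sr_eqv (sr_opp x) (sr_opp y);
  sr_add_eqv : forall x y z t,
    sr_eqv x y -> sr_eqv z t -> sr_eqv (sr_add x z) (sr_add y t);
  sr_mul_eqv : forall x y z t,
    sr_eqv x y -> sr_eqv z t -> sr_eqv (sr_mul x z) (sr_mul y t);
  sr_addA : forall x y z,
    sr_eqv (sr_add x (sr_add y z)) (sr_add (sr_add x y) z);
  sr_addC : forall x y, sr_eqv (sr_add x y) (sr_add y x);
  sr_add0 : forall x, sr_eqv (sr_add sr_zero x) x;
  sr_addN : forall x, sr_eqv (sr_add (sr_opp x) x) sr_zero;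
  sr_mulA : forall x y z,
    sr_eqv (sr_mul x (sr_mul y z)) (sr_mul (sr_mul x y) z);
  sr_mulC : forall x y, sr_eqv (sr_mul x y) (sr_mul y x);
  sr_mul1 : forall x, sr_eqv (sr_mul sr_one x) x;
  sr_mulDl : forall x y z,
    sr_eqv (sr_mul (sr_add x y) z) (sr_add (sr_mul x z) (sr_mul y z))
}.

Section SetoidQuotient.
Variable S : setoid_ring.
Local Notation T := {classic (sr_sort S)}.

Definition sr_eqb : rel T := fun x y => `[< @sr_eqv S x y >].

Lemma sr_eqb_equiv : equiv_class_of sr_eqb.
Proof.
split=> [x|x y|y x z].
- by apply/asboolP; exact: sr_refl.
- by apply/asboolP/asboolP; exact: sr_sym.
- by move=> /asboolP xy /asboolP yz; apply/asboolP; exact: sr_trans xy yz.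
Qed.

Canonical sr_rel := EquivRelPack sr_eqb_equiv.

Definition quot_ring : Type := {eq_quot sr_rel}.
HB.instance Definition _ := Choice.copy quot_ring {eq_quot sr_rel}.

Definition quot_pi (x : sr_sort S) : quot_ring := \pi_{eq_quot sr_rel} (x : T).
Definition quot_repr (q : quot_ring) : sr_sort S :=
  repr (q : {eq_quot sr_rel}).

Lemma quot_reprK q : quot_pi (quot_repr q) = q.
Proof. exact: (@reprK _ {eq_quot sr_rel}). Qed.

Lemma quot_piP x y : quot_pi x = quot_pi y <-> sr_eqv x y.
Proof. by split=> [/eqmodP/asboolP//|xy]; apply/eqmodP/asboolP. Qed.

Lemma quot_repr_pi x : sr_eqv (quot_repr (quot_pi x)) x.
Proof. by apply/quot_piP; rewrite quot_reprK. Qed.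

Definition quot_zero := quot_pi (sr_zero S).
Definition quot_one := quot_pi (sr_one S).
Definition quot_opp x := quot_pi (sr_opp (quot_repr x)).
Definition quot_add x y := quot_pi (sr_add (quot_repr x) (quot_repr y)).
Definition quot_mul x y := quot_pi (sr_mul (quot_repr x) (quot_repr y)).

Lemma quot_pi_opp x : quot_opp (quot_pi x) = quot_pi (sr_opp x).
Proof. by apply/quot_piP/sr_opp_eqv/quot_repr_pi. Qed.

Lemma quot_pi_add x y : quot_add (quot_pi x) (quot_pi y) = quot_pi (sr_add x y).
Proof. by apply/quot_piP/sr_add_eqv; exact: quot_repr_pi. Qed.

Lemma quot_pi_mul x y : quot_mul (quot_pi x) (quot_pi y) = quot_pi (sr_mul x y).
Proof. by apply/quot_piP/sr_mul_eqv; exact: quot_repr_pi. Qed.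

Lemma quot_ind (P : quot_ring -> Prop) :
  (forall x, P (quot_pi x)) -> forall q, P q.
Proof. by move=> Ppi q; rewrite -(quot_reprK q). Qed.

Lemma quot_addA : associative quot_add.
Proof.
move=> x y z; elim/quot_ind: x => x.
elim/quot_ind: y => y; elim/quot_ind: z => z.
by rewrite !quot_pi_add; apply/quot_piP/sr_addA.
Qed.

Lemma quot_addC : commutative quot_add.
Proof.
move=> x y; elim/quot_ind: x => x; elim/quot_ind: y => y.
by rewrite !quot_pi_add; apply/quot_piP/sr_addC.
Qed.

Lemma quot_add0 : left_id quot_zero quot_add.
Proof. by elim/quot_ind=> x; rewrite quot_pi_add; apply/quot_piP/sr_add0. Qed.

Lemma quot_addN : left_inverse quot_zero quot_opp quot_add.
Proof.
by elim/quot_ind=> x; rewrite quot_pi_opp quot_pi_add; apply/quot_piP/sr_addN.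
Qed.

HB.instance Definition _ :=
  GRing.isZmodule.Build quot_ring quot_addA quot_addC quot_add0 quot_addN.

Lemma quot_mulA : associative quot_mul.
Proof.
move=> x y z; elim/quot_ind: x => x.
elim/quot_ind: y => y; elim/quot_ind: z => z.
by rewrite !quot_pi_mul; apply/quot_piP/sr_mulA.
Qed.

Lemma quot_mulC : commutative quot_mul.
Proof.
move=> x y; elim/quot_ind: x => x; elim/quot_ind: y => y.
by rewrite !quot_pi_mul; apply/quot_piP/sr_mulC.
Qed.

Lemma quot_mul1 : left_id quot_one quot_mul.
Proof. by elim/quot_ind=> x; rewrite quot_pi_mul; apply/quot_piP/sr_mul1. Qed.

Lemma quot_mulDl : left_distributive quot_mul quot_add.
Proof.
move=> x y z; elim/quot_ind: x => x.
elim/quot_ind: y => y; elim/quot_ind: z => z.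
by rewrite quot_pi_add !quot_pi_mul quot_pi_add; apply/quot_piP/sr_mulDl.
Qed.

HB.instance Definition _ := GRing.Zmodule_isComPzRing.Build quot_ring
  quot_mulA quot_mulC quot_mul1 quot_mulDl.

End SetoidQuotient.

Record spec (A : comPzRingType) : Type := SpecPoint {
  spec_ideal :> A -> Prop;
  spec_prime : prime_ideal spec_ideal
}.
HB.instance Definition _ (A : comPzRingType) := gen_eqMixin (spec A).
HB.instance Definition _ (A : comPzRingType) := gen_choiceMixin (spec A).

Section ZariskiTopology.
Variable A : comPzRingType.

Definition vanishing_locus (E : set A) : set (spec A) := [set p | E `<=` p].

Definition zariski_open : set_system (spec A) :=
  [set U | exists E : set A, U = ~` vanishing_locus E].

Lemma zariski_openT : zariski_open setT.
Proof.
exists [set 1]; apply/seteqP; split=> // p _ /(_ 1 erefl).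
by case: (spec_prime p).
Qed.

Lemma zariski_openI : setI_closed zariski_open.
Proof.
move=> _ _ [E ->] [F ->]; exists [set e * f | e in E & f in F].
rewrite -setCU; congr (~` _); apply/seteqP; split=> p.
  have [[_ _ pM] _ _] := spec_prime p.
  move=> [pE|pF] _ [e Ee [f Ff <-]]; last exact/pM/pF.
  by rewrite mulrC; exact/pM/pE.
move=> pEF; apply: contrapT => /not_orP[/existsNP[e /not_implyP[Ee npe]]].
move=> /existsNP[f /not_implyP[Ff npf]].
have [_ _ pP] := spec_prime p.
by case: (pP e f) => //; apply: pEF; exists e => //; exists f.
Qed.

Lemma zariski_open_bigU (I : Type) (f : I -> set (spec A)) :
  (forall i, zariski_open (f i)) -> zariski_open (\bigcup_i f i).
Proof.
move=> fo; exists (\bigcup_i projT1 (cid (fo i))).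
apply/seteqP; split=> [p [i _ + pE]|p].
  by rewrite (projT2 (cid (fo i))); apply=> a Ea; apply: pE; exists i.
move=> npE; apply: contrapT => npf; apply: npE => a [i _ Ea].
apply: contrapT => npa; apply: npf; exists i => //.
by rewrite (projT2 (cid (fo i))) => /(_ _ Ea).
Qed.

HB.instance Definition _ := isOpenTopological.Build (spec A)
  zariski_openT zariski_openI zariski_open_bigU.

End ZariskiTopology.

Section Localization.
Variables (A : comPzRingType) (p : spec A).

Record fraction := Fraction {
  numerator : A;
  denominator : A;
  denominatorP : ~ p denominator
}.

Lemma spec_compl1 : ~ p 1.
Proof. by case: (spec_prime p). Qed.

Lemma spec_complM a b : ~ p a -> ~ p b -> ~ p (a * b).
Proof. by case: (spec_prime p) => _ _ pM pa pb /pM[]. Qed.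

Definition frac_eqv (x y : fraction) : Prop :=
  exists2 h : A, ~ p h &
    h * (numerator x * denominator y) = h * (numerator y * denominator x).

Definition frac_zero := Fraction 0 spec_compl1.
Definition frac_one := Fraction 1 spec_compl1.
Definition frac_opp (x : fraction) :=
  Fraction (- numerator x) (@denominatorP x).
Definition frac_add (x y : fraction) :=
  Fraction (numerator x * denominator y + numerator y * denominator x)
           (spec_complM (@denominatorP x) (@denominatorP y)).
Definition frac_mul (x y : fraction) :=
  Fraction (numerator x * numerator y)
           (spec_complM (@denominatorP x) (@denominatorP y)).

Lemma frac_eq_eqv x y :
  numerator x * denominator y = numerator y * denominator x -> frac_eqv x y.
Proof. by move=> xy; exists 1; [exact: spec_compl1|rewrite xy]. Qed.

Definition localization_setoid : setoid_ring.
Proof.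
apply: (@SetoidRing fraction frac_eqv frac_zero frac_one
                    frac_opp frac_add frac_mul).
- by move=> x; exact: frac_eq_eqv.
- by move=> x y [h ph xy]; exists h.
- move=> [a f pf] [b g pg] [c l pl] [h /= ph xy] [k /= pk yz].
  exists (h * k * g) => /=; first by do !apply: spec_complM.
  transitivity (k * l * (h * (a * g))); first by ring.
  rewrite xy; transitivity (h * f * (k * (b * l))); first by ring.
  by rewrite yz; ring.
- move=> [a f pf] [b g pg] [h /= ph xy]; exists h => //=.
  by rewrite !mulNr !mulrN xy.
- move=> [a f pf] [b g pg] [c k pk] [d l pl] [h /= ph xy] [i /= ppi zt].
  exists (h * i) => /=; first exact: spec_complM.
  transitivity (i * k * l * (h * (a * g)) + h * f * g * (i * (c * l))).
    by ring.
  by rewrite xy zt; ring.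
- move=> [a f pf] [b g pg] [c k pk] [d l pl] [h /= ph xy] [i /= ppi zt].
  exists (h * i) => /=; first exact: spec_complM.
  transitivity ((h * (a * g)) * (i * (c * l))); first by ring.
  by rewrite xy zt; ring.
- by move=> *; apply: frac_eq_eqv => /=; ring.
- by move=> *; apply: frac_eq_eqv => /=; ring.
- by move=> *; apply: frac_eq_eqv => /=; ring.
- by move=> *; apply: frac_eq_eqv => /=; ring.
- by move=> *; apply: frac_eq_eqv => /=; ring.
- by move=> *; apply: frac_eq_eqv => /=; ring.
- by move=> *; apply: frac_eq_eqv => /=; ring.
- by move=> *; apply: frac_eq_eqv => /=; ring.
Defined.

Definition localization : comPzRingType := quot_ring localization_setoid.

Definition to_frac (a f : A) (pf : ~ p f) : localization :=
  @quot_pi localization_setoid (Fraction a pf).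

Lemma to_frac0 : to_frac 0 spec_compl1 = 0. Proof. by []. Qed.

Lemma to_frac1 : to_frac 1 spec_compl1 = 1. Proof. by []. Qed.

Lemma to_fracN a f (pf : ~ p f) : - to_frac a pf = to_frac (- a) pf.
Proof. exact: quot_pi_opp. Qed.

Lemma to_fracD a f (pf : ~ p f) b g (pg : ~ p g) :
  to_frac a pf + to_frac b pg = to_frac (a * g + b * f) (spec_complM pf pg).
Proof. exact: quot_pi_add. Qed.

Lemma to_fracM a f (pf : ~ p f) b g (pg : ~ p g) :
  to_frac a pf * to_frac b pg = to_frac (a * b) (spec_complM pf pg).
Proof. exact: quot_pi_mul. Qed.

End Localization.

Record opens (X : topologicalType) : Type := Opens {
  opens_set :> X -> Prop;
  opens_open : open (opens_set : set X)
}.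

Definition opensT (X : topologicalType) : opens X := Opens (@openT X).

Definition opensI (X : topologicalType) (U V : opens X) : opens X :=
  Opens (openI (opens_open U) (opens_open V)).

Lemma opensIl (X : topologicalType) (U V : opens X) : opensI U V `<=` U.
Proof. exact: subIsetl. Qed.

Lemma opensIr (X : topologicalType) (U V : opens X) : opensI U V `<=` V.
Proof. exact: subIsetr. Qed.

Definition opens_preimage (X Y : topologicalType) (f : X -> Y)
    (fc : continuous f) (V : opens Y) : opens X :=
  Opens (proj1 (continuousP f) fc V (opens_open V)).

(* The gluing axiom is not part of this record: [scheme] imposes it on the
   whole space, and it then passes to open subspaces. *)
Record presheafed_space : Type := PresheafedSpace {
  ps_space :> topologicalType;
  sections : opens ps_space -> comPzRingType;
  restr : forall U V : opens ps_space,
    V `<=` U -> {rmorphism sections U -> sections V};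
  restr_id : forall (U : opens ps_space) (UU : U `<=` U) (s : sections U),
    restr UU s = s;
  restr_comp : forall (U V W : opens ps_space)
    (VU : V `<=` U) (WV : W `<=` V) (WU : W `<=` U) (s : sections U),
    restr WV (restr VU s) = restr WU s
}.
Arguments restr {p U V}.
Arguments restr_id {p U}.
Arguments restr_comp {p U V W}.

Lemma restr_trans (X : presheafed_space) (U V W : opens X)
    (VU : V `<=` U) (WV : W `<=` V) (s : sections U) :
  restr WV (restr VU s) = restr (subset_trans WV VU) s.
Proof. exact: restr_comp. Qed.

Lemma restr_irr (X : presheafed_space) (U V : opens X) (h h' : V `<=` U) :
  restr h =1 restr h'.
Proof. by rewrite (Prop_irrelevance h h'). Qed.

Definition is_sheaf (X : presheafed_space) : Prop :=
  forall (I : Type) (U : opens X) (V : I -> opens X)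
    (VU : forall i, V i `<=` U),
    U `<=` \bigcup_i V i ->
  forall s : forall i, sections (V i),
    (forall i j, restr (@opensIl _ (V i) (V j)) (s i) =
                 restr (@opensIr _ (V i) (V j)) (s j)) ->
  exists! t : sections U, forall i, restr (VU i) t = s i.

Section Stalk.
Variables (X : presheafed_space) (x : X).

Record germ_rep : Type := GermRep {
  germ_nbhd : opens X;
  germ_mem : germ_nbhd x;
  germ_sec : sections germ_nbhd
}.

Definition germ_eqv (s t : germ_rep) : Prop :=
  exists W : opens X, W x /\
  exists (Ws : W `<=` germ_nbhd s) (Wt : W `<=` germ_nbhd t),
    restr Ws (germ_sec s) = restr Wt (germ_sec t).

Definition germ_zero := @GermRep (opensT X) I 0.
Definition germ_one := @GermRep (opensT X) I 1.
Definition germ_opp (s : germ_rep) :=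
  @GermRep (germ_nbhd s) (germ_mem s) (- germ_sec s).

Definition germ_op2 (op : forall U, sections U -> sections U -> sections U)
    (s t : germ_rep) :=
  @GermRep (opensI (germ_nbhd s) (germ_nbhd t))
    (conj (germ_mem s) (germ_mem t))
    (op (opensI (germ_nbhd s) (germ_nbhd t))
        (restr (@opensIl _ _ _) (germ_sec s))
        (restr (@opensIr _ _ _) (germ_sec t))).
Definition germ_add := germ_op2 (fun _ => +%R).
Definition germ_mul := germ_op2 (fun _ => *%R).

Lemma germ_op2_eqv (op : forall U, sections U -> sections U -> sections U)
    (restr_op : forall (U V : opens X) (VU : V `<=` U),
      {morph restr VU : a b / op U a b >-> op V a b}) (s s' t t' : germ_rep) :
  germ_eqv s s' -> germ_eqv t t' ->
  germ_eqv (germ_op2 op s t) (germ_op2 op s' t').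
Proof.
case: s s' t t' => [U Ux s] [V Vx s'] [U' U'x t] [V' V'x t'].
move=> [W [Wx [/= WU [WV st]]]] [W' [W'x [/= W'U [W'V st']]]].
exists (opensI W W'); split=> //=.
exists (setISS WU W'U), (setISS WV W'V); rewrite !restr_op.
rewrite (restr_comp _ _ (subset_trans (@opensIl _ W W') WU)).
rewrite (restr_comp _ _ (subset_trans (@opensIr _ W W') W'U)).
rewrite (restr_comp _ _ (subset_trans (@opensIl _ W W') WV)).
rewrite (restr_comp _ _ (subset_trans (@opensIr _ W W') W'V)).
rewrite -(restr_comp WU (@opensIl _ _ _)) st.
rewrite -(restr_comp W'U (@opensIr _ _ _)) st'.
by congr (op _ _ _); exact: restr_comp.
Qed.

Definition stalk_setoid : setoid_ring.
Proof.
apply: (@SetoidRing germ_rep germ_eqv germ_zero germ_one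
                    germ_opp germ_add germ_mul).
- by move=> [U Ux s]; exists U; split=> //; exists (fun _ => id), (fun _ => id).
- by move=> s t [W [Wx [Ws [Wt st]]]]; exists W; split=> //; exists Wt, Ws.
- move=> [U Ux s] [V Vx t] [Z Zx u] [W [Wx [/= WU [WV st]]]].
  move=> [W' [W'x [/= W'V [W'Z tu]]]]; exists (opensI W W'); split=> //=.
  exists (subset_trans (@opensIl _ W W') WU).
  exists (subset_trans (@opensIr _ W W') W'Z).
  have WW'V : opensI W W' `<=` V by move=> y [/WV].
  rewrite -(restr_comp WU (@opensIl _ _ _)) st (restr_comp _ _ WW'V).
  by rewrite -(restr_comp W'Z (@opensIr _ _ _)) -tu (restr_comp _ _ WW'V).
- move=> [U Ux s] [V Vx t] [W [Wx [/= WU [WV st]]]]; exists W; split=> //=.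
  by exists WU, WV; rewrite !rmorphN st.
- by move=> ????; apply: germ_op2_eqv => U V VU a b; rewrite rmorphD.
- by move=> ????; apply: germ_op2_eqv => U V VU a b; rewrite rmorphM.
- move=> [U Ux s] [V Vx t] [Z Zx u]; pose W := opensI (opensI U V) Z.
  have Wl : W `<=` opensI U (opensI V Z) by move=> ? [[]].
  exists W; split=> [//|]; exists Wl; exists (fun _ => id) => /=.
  rewrite !rmorphD !restr_trans addrA.
  by congr (_ + _ + _); exact: restr_irr.
- move=> [U Ux s] [V Vx t].
  have UV : opensI U V `<=` opensI V U by move=> ? [].
  exists (opensI U V); split=> //; exists (fun _ => id), UV => /=.
  rewrite !rmorphD !(restr_comp _ _ (@opensIl _ U V)).
  by rewrite !(restr_comp _ _ (@opensIr _ U V)) addrC.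
- move=> [U Ux s]; have UT : U `<=` opensI (opensT X) U by [].
  exists U; split=> //; exists UT, (fun _ => id) => /=.
  by rewrite !rmorphD !rmorph0 add0r (restr_comp _ _ (fun _ => id)).
- move=> [U Ux s]; exists (opensI U U); split=> //.
  exists (fun _ => id), (fun _ _ => I) => /=.
  rewrite !rmorphD !rmorph0 !rmorphN !(restr_comp _ _ (@opensIl _ U U)).
  by rewrite addNr.
- move=> [U Ux s] [V Vx t] [Z Zx u]; pose W := opensI (opensI U V) Z.
  have Wl : W `<=` opensI U (opensI V Z) by move=> ? [[]].
  exists W; split=> [//|]; exists Wl; exists (fun _ => id) => /=.
  rewrite !rmorphM !restr_trans mulrA.
  by congr (_ * _ * _); exact: restr_irr.
- move=> [U Ux s] [V Vx t].
  have UV : opensI U V `<=` opensI V U by move=> ? [].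
  exists (opensI U V); split=> //; exists (fun _ => id), UV => /=.
  rewrite !rmorphM !(restr_comp _ _ (@opensIl _ U V)).
  by rewrite !(restr_comp _ _ (@opensIr _ U V)) mulrC.
- move=> [U Ux s]; have UT : U `<=` opensI (opensT X) U by [].
  exists U; split=> //; exists UT, (fun _ => id) => /=.
  by rewrite !rmorphM !rmorph1 mul1r (restr_comp _ _ (fun _ => id)).
- move=> [U Ux s] [V Vx t] [Z Zx u]; pose W := opensI (opensI U V) Z.
  have Wr : W `<=` opensI (opensI U Z) (opensI V Z) by move=> ? [[]].
  exists W; split=> //; exists (fun _ => id), Wr => /=.
  rewrite !(rmorphD, rmorphM) /=.
  rewrite !restr_trans mulrDl.
  by congr (_ * _ + _ * _); exact: restr_irr.
Defined.

Definition stalk : comPzRingType := quot_ring stalk_setoid.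

Definition germ (U : opens X) (Ux : U x) (s : sections U) : stalk :=
  @quot_pi stalk_setoid (GermRep Ux s).

End Stalk.

Section SpecSections.
Variable A : comPzRingType.
Implicit Types U V W : opens (spec A).

(* O(U) consists of the functions sending p in U to an element of A_p that are
   locally of the form a / f. *)
Definition locally_fraction U (s : forall p : spec A, U p -> localization p) :
    Prop :=
  forall p : spec A, U p ->
  exists V : opens (spec A), [/\ V p, V `<=` U &
    exists a f : A, forall (q : spec A) (Uq : U q), V q ->
      exists fq : ~ q f, s q Uq = to_frac a fq].

Record spec_section U : Type := SpecSection {
  ss_fun :> forall p : spec A, U p -> localization p;
  ss_fraction : locally_fraction ss_fun
}.

HB.instance Definition _ U := gen_eqMixin (spec_section U).
HB.instance Definition _ U := gen_choiceMixin (spec_section U).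

Section Ring.
Variable U : opens (spec A).
Implicit Types s t : spec_section U.

Lemma ss_ext s t : (forall p (Up : U p), s p Up = t p Up) -> s = t.
Proof.
case: s t => [s sP] [t tP] /= st.
have {}st : s = t by apply: functional_extensionality_dep => p; exact/funext/st.
by rewrite {s}st in sP *; rewrite (Prop_irrelevance sP tP).
Qed.

Lemma ss_const_fraction (c : A) :
  locally_fraction (fun p (_ : U p) => to_frac c (@spec_compl1 A p)).
Proof.
move=> p Up; exists U; split=> //; exists c, 1 => q _ _.
by exists (@spec_compl1 A q).
Qed.

Lemma ss_opp_fraction s : locally_fraction (fun p (Up : U p) => - s p Up).
Proof.
move=> p Up; have [V [Vp VU [a [f sE]]]] := ss_fraction s Up.
exists V; split=> //; exists (- a), f => q Uq Vq.
by have [fq ->] := sE q Uq Vq; exists fq; rewrite to_fracN.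
Qed.

Lemma ss_add_fraction s t :
  locally_fraction (fun p (Up : U p) => s p Up + t p Up).
Proof.
move=> p Up; have [V [Vp VU [a [f sE]]]] := ss_fraction s Up.
have [W [Wp WU [b [g tE]]]] := ss_fraction t Up.
exists (opensI V W); split=> // [q [/VU]//|].
exists (a * g + b * f), (f * g) => q Uq [Vq Wq].
have [fq ->] := sE q Uq Vq; have [gq ->] := tE q Uq Wq.
by exists (spec_complM fq gq); rewrite to_fracD.
Qed.

Lemma ss_mul_fraction s t :
  locally_fraction (fun p (Up : U p) => s p Up * t p Up).
Proof.
move=> p Up; have [V [Vp VU [a [f sE]]]] := ss_fraction s Up.
have [W [Wp WU [b [g tE]]]] := ss_fraction t Up.
exists (opensI V W); split=> // [q [/VU]//|].
exists (a * b), (f * g) => q Uq [Vq Wq].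
have [fq ->] := sE q Uq Vq; have [gq ->] := tE q Uq Wq.
by exists (spec_complM fq gq); rewrite to_fracM.
Qed.

Let ss0 := SpecSection (ss_const_fraction 0).
Let ss1 := SpecSection (ss_const_fraction 1).
Let ssN s := SpecSection (ss_opp_fraction s).
Let ssD s t := SpecSection (ss_add_fraction s t).
Let ssM s t := SpecSection (ss_mul_fraction s t).

Lemma ss_addA : associative ssD.
Proof. by move=> s t u; apply: ss_ext => p Up /=; rewrite addrA. Qed.

Lemma ss_addC : commutative ssD.
Proof. by move=> s t; apply: ss_ext => p Up /=; rewrite addrC. Qed.

Lemma ss_add0 : left_id ss0 ssD.
Proof. by move=> s; apply: ss_ext => p Up /=; rewrite to_frac0 add0r. Qed.

Lemma ss_addN : left_inverse ss0 ssN ssD.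
Proof. by move=> s; apply: ss_ext => p Up /=; rewrite to_frac0 addNr. Qed.

HB.instance Definition _ :=
  GRing.isZmodule.Build (spec_section U) ss_addA ss_addC ss_add0 ss_addN.

Lemma ss_mulA : associative ssM.
Proof. by move=> s t u; apply: ss_ext => p Up /=; rewrite mulrA. Qed.

Lemma ss_mulC : commutative ssM.
Proof. by move=> s t; apply: ss_ext => p Up /=; rewrite mulrC. Qed.

Lemma ss_mul1 : left_id ss1 ssM.
Proof. by move=> s; apply: ss_ext => p Up /=; rewrite to_frac1 mul1r. Qed.

Lemma ss_mulDl : left_distributive ssM ssD.
Proof. by move=> s t u; apply: ss_ext => p Up /=; rewrite mulrDl. Qed.

HB.instance Definition _ := GRing.Zmodule_isComPzRing.Build (spec_section U)
  ss_mulA ss_mulC ss_mul1 ss_mulDl.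

End Ring.

Section Restriction.
Variables (U V : opens (spec A)) (VU : V `<=` U).

Lemma ss_restr_fraction (s : spec_section U) :
  locally_fraction (fun p (Vp : V p) => s p (VU Vp)).
Proof.
move=> p Vp; have [W [Wp WU [a [f sE]]]] := ss_fraction s (VU Vp).
exists (opensI V W); split=> // [q []//|].
by exists a, f => q Vq [_ Wq]; exact: sE.
Qed.

Definition ss_restr (s : spec_section U) : spec_section V :=
  SpecSection (ss_restr_fraction s).

Lemma ss_restr_zmod_morphism : zmod_morphism ss_restr.
Proof. by move=> s t; exact: ss_ext. Qed.

Lemma ss_restr_monoid_morphism : monoid_morphism ss_restr.
Proof. by split=> [|s t]; exact: ss_ext. Qed.

HB.instance Definition _ := GRing.isZmodMorphism.Build _ _ ss_restr
  ss_restr_zmod_morphism.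
HB.instance Definition _ := GRing.isMonoidMorphism.Build _ _ ss_restr
  ss_restr_monoid_morphism.

End Restriction.

Lemma ss_restr_id U (UU : U `<=` U) (s : spec_section U) : ss_restr UU s = s.
Proof. by apply: ss_ext => p Up /=; rewrite (Prop_irrelevance (UU p Up) Up). Qed.

Lemma ss_restr_comp U V W (VU : V `<=` U) (WV : W `<=` V) (WU : W `<=` U)
  (s : spec_section U) : ss_restr WV (ss_restr VU s) = ss_restr WU s.
Proof.
by apply: ss_ext => p Wp /=; rewrite (Prop_irrelevance (VU p _) (WU p Wp)).
Qed.

Definition Spec : presheafed_space :=
  @PresheafedSpace (spec A) (fun U => spec_section U)
    (fun U V VU => @ss_restr U V VU) ss_restr_id ss_restr_comp.

End SpecSections.

Section OpenSubspace.
Variables (X : presheafed_space) (U : opens X).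

Lemma open_image_set_val (W : opens (set_type (U : set X))) :
  open (set_val @` W : set X).
Proof.
have [B Bo BW] := opens_open W.
suff -> : (set_val @` W : set X) = B `&` U by exact: openI Bo (opens_open U).
rewrite -BW; apply/seteqP; split=> [_ [y By <-]|y [By Uy]].
  by split=> //; exact: set_valP.
by exists (SigSub (mem_set Uy)).
Qed.

Definition opens_image (W : opens (set_type (U : set X))) : opens X :=
  Opens (open_image_set_val W).

Lemma opens_image_subset (V W : opens (set_type (U : set X))) :
  W `<=` V -> opens_image W `<=` opens_image V.
Proof. exact: image_subset. Qed.

(* [set_type] carries the initial topology; the library's [subspace U] would
   instead keep all of X and isolate the points outside U. *)
Definition open_subspace : presheafed_space :=
  @PresheafedSpace (set_type (U : set X))
    (fun W => sections (opens_image W))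
    (fun V W WV => restr (opens_image_subset WV))
    (fun V VV => restr_id (opens_image_subset VV))
    (fun V W T WV TW TV => restr_comp (opens_image_subset WV)
       (opens_image_subset TW) (opens_image_subset TV)).

End OpenSubspace.

Record morphism (X Y : presheafed_space) : Type := Morphism {
  mor_fun :> X -> Y;
  mor_continuous : continuous mor_fun;
  mor_sharp : forall V : opens Y,
    {rmorphism sections V -> sections (opens_preimage mor_continuous V)};
  mor_natural : forall (V W : opens Y) (WV : W `<=` V) (s : sections V),
    mor_sharp W (restr WV s) =
    restr (preimage_subset WV :
      opens_preimage mor_continuous W `<=` opens_preimage mor_continuous V)
      (mor_sharp V s)
}.

Definition is_isomorphism (X Y : presheafed_space) (m : morphism X Y) : Prop :=
  (exists g : Y -> X, [/\ continuous g, cancel m g & cancel g m]) /\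
  (forall V : opens Y, bijective (mor_sharp m V)).

Definition isomorphic (X Y : presheafed_space) : Prop :=
  exists m : morphism X Y, is_isomorphism m.

Definition is_affine (X : presheafed_space) : Prop :=
  exists A : comPzRingType, isomorphic X (Spec A).

(* An isomorphism of ringed spaces induces isomorphisms on stalks, so that it
   is automatically one of locally ringed spaces. *)
Record scheme : Type := Scheme {
  scheme_space :> presheafed_space;
  scheme_sheaf : is_sheaf scheme_space;
  scheme_local : forall x : scheme_space, local_ring (stalk x);
  scheme_affine : forall x : scheme_space,
    exists U : opens scheme_space, U x /\ is_affine (open_subspace U)
}.

(* Taking F = set0 shows that irreducible spaces are nonempty. *)
Definition irreducible_space (T : topologicalType) : Prop :=
  forall F : set (set T), finite_set F ->
    (forall U, F U -> open U /\ U !=set0) ->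
    \bigcap_(U in F) U !=set0.

Definition irreducible_subset (T : topologicalType) (Z : set T) : Prop :=
  irreducible_space (set_type Z).

Definition locally_irreducible_space (T : topologicalType) : Prop :=
  forall x : T, exists2 N : set T, nbhs x N & irreducible_subset N.

Definition irreducible_components (T : topologicalType) : set (set T) :=
  [set Z | irreducible_subset Z /\
    forall Z' : set T, irreducible_subset Z' -> Z `<=` Z' -> Z' = Z].
Arguments irreducible_components : clear implicits.

Definition locally_finite_family (T : topologicalType) (F : set (set T)) :
    Prop :=
  forall x : T, exists2 N : set T, nbhs x N &
    finite_set [set Z | F Z /\ Z `&` N !=set0].

Definition irreducible_ring (A : comPzRingType) : Prop :=
  irreducible_space (spec A).

Definition reduced (X : scheme) : Prop := forall x : X, reduced_ring (stalk x).

Definition pointwise_irreducible (X : scheme) : Prop :=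
  forall x : X, irreducible_ring (stalk x).

Definition integral (X : scheme) : Prop := reduced X /\ irreducible_space X.

Definition locally_integral (X : scheme) : Prop :=
  reduced X /\ locally_irreducible_space X.

Definition pointwise_integral (X : scheme) : Prop :=
  reduced X /\ pointwise_irreducible X.

(* Main.v *)
(** Being reduced makes irreducibility of a stalk the same as being a domain.
    If an irreducible open set contains x, then two germs at x with product zero
    have representatives a, b in an affine chart whose nonvanishing loci are
    disjoint near x; one locus is empty, so a or b is nilpotent, hence zero.
    Conversely, if the stalk at x is a domain, the kernel of A -> O_{X,x} for an
    affine chart Spec A is a prime whose closure contains every irreducible
    subset through x: exactly one irreducible component passes through x.  With
    local finiteness, discarding the other nearby components, which are closed,
    leaves an irreducible neighbourhood of x.  Finally, in a locally irreducible
    space the closure of an irreducible open subset is open, so that it is the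
    whole space when the latter is connected. *)
Require Import Defs.
From mathcomp Require Import all_boot all_algebra.
From mathcomp Require Import mathcomp_extra boolp classical_sets functions.
From mathcomp Require Import cardinality topology.
From mathcomp Require Import ring.

Set Implicit Arguments.
Unset Strict Implicit.
Unset Printing Implicit Defensive.

Import GRing.Theory.
Local Open Scope classical_set_scope.
Local Open Scope ring_scope.

(** * Irreducible subsets *)

(** Phrased through open sets of [T] instead of the subtype [set_type Z]; nonemptiness and pairs
    stand for the condition on finite families. *)
Definition irreducible_in (T : topologicalType) (Z : set T) : Prop :=
  Z !=set0 /\ forall U V : set T, open U -> open V ->
    Z `&` U !=set0 -> Z `&` V !=set0 -> Z `&` (U `&` V) !=set0.

Lemma irreducible_spaceP (T : topologicalType) :
  irreducible_space T <-> irreducible_in [set: T].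
Proof.
split=> [irrT|[[x _] irrT] F /finite_seqP[s ->]].
  split=> [|U V Uo Vo]; last rewrite !setTI => U0 V0.
    by have [|//|x _] := irrT set0; [exact: finite_set0|exists x].
  have [||x UVx] := irrT [set U; V]; first exact: finite_set2.
    by move=> _ [] ->.
  by exists x; split; apply: UVx; [left|right].
suff irrs U : open U -> U !=set0 ->
    (forall V, V \in s -> open V /\ V !=set0) ->
    U `&` \bigcap_(V in [set` s]) V !=set0.
  move=> so; have [||//|y [_ ys]] := irrs setT.
  - exact: openT.
  - by exists x.
  - by exists y.
elim: s U => [|V s IHs] U Uo U0 so.
  by rewrite set_nil bigcap_set0 setIT.
have [Vo V0] := so V (mem_head _ _).
have [||y [_ UVy]] := irrT U V Uo Vo; rewrite ?setTI//.
have [|||z [[Uz Vz] sz]] := IHs (U `&` V); first exact: openI.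
- by exists y.
- by move=> W Ws; apply: so; rewrite inE Ws orbT.
exists z; split=> // W /=; rewrite inE => /orP[/eqP->//|Ws]; exact: sz.
Qed.

Section Irreducible.
Variable T : topologicalType.
Implicit Types Z U V N : set T.

Lemma irreducible_subsetP Z : irreducible_subset Z <-> irreducible_in Z.
Proof.
rewrite /irreducible_subset irreducible_spaceP.
split=> [[[x _] irrZ]|[[x Zx] irrZ]].
  split=> [|U V Uo Vo [u [Zu Uu]] [v [Zv Vv]]].
    by exists (val x); exact: set_valP.
  have [||||z [_ [Uz Vz]]] := irrZ (set_val @^-1` U) (set_val @^-1` V).
  - by exists U.
  - by exists V.
  - by exists (SigSub (mem_set Zu)).
  - by exists (SigSub (mem_set Zv)).
  - by exists (val z); split; [exact: set_valP|].
split=> [|_ _ [U Uo <-] [V Vo <-] [u [_ Uu]] [v [_ Vv]]].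
  by exists (SigSub (mem_set Zx)).
have [||||z [Zz [Uz Vz]]] := irrZ U V => //.
- by exists (val u); split; [exact: set_valP|].
- by exists (val v); split; [exact: set_valP|].
- by exists (SigSub (mem_set Zz)).
Qed.

(** An open set that meets the closure of [Z] already meets [Z]. *)
Lemma irreducible_in_closure Z : irreducible_in Z -> irreducible_in (closure Z).
Proof.
have meet U : open U -> closure Z `&` U !=set0 -> Z `&` U !=set0.
  by move=> Uo [x [clx Ux]]; apply: clx; exact: open_nbhs_nbhs.
move=> [[x Zx] irrZ]; split=> [|U V Uo Vo /meet-/(_ Uo) ZU /meet-/(_ Vo) ZV].
  by exists x; exact: subset_closure.
have [y [Zy UVy]] := irrZ U V Uo Vo ZU ZV.
by exists y; split=> //; exact: subset_closure.
Qed.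

Lemma irreducible_in_open Z U :
  irreducible_in Z -> open U -> U `<=` Z -> U !=set0 -> irreducible_in U.
Proof.
move=> [_ irrZ] Uo UZ U0; split=> // V W Vo Wo UV UW.
have [||||z [Zz [[Uz Vz] [_ Wz]]]] := irrZ (U `&` V) (U `&` W).
- exact: openI.
- exact: openI.
- by have [v [Uv Vv]] := UV; exists v; split=> //; exact: UZ.
- by have [v [Uv Vv]] := UW; exists v; split=> //; exact: UZ.
- by exists z.
Qed.

Lemma irreducible_in_set1 (x : T) : irreducible_in [set x].
Proof.
split=> [|U V _ _ [_ [-> Ux]] [_ [-> Vx]]]; first by exists x.
by exists x.
Qed.

(** Nonempty open parts are dense: every open neighbourhood of a point of [Z] meets [U] inside
    [Z]. *)
Lemma irreducible_in_sub_closure Z U :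
  irreducible_in Z -> open U -> Z `&` U !=set0 -> Z `<=` closure (Z `&` U).
Proof.
move=> [_ irrZ] Uo ZU x Zx B; rewrite nbhsE => -[V [Vo Vx] VB].
have [|z [Zz [Uz Vz]]] := irrZ U V Uo Vo ZU; first by exists x.
by exists z; split=> //; exact: VB.
Qed.

Lemma irreducible_component_closed Z : irreducible_components T Z -> closed Z.
Proof.
move=> [/irreducible_subsetP irrZ maxZ].
suff <- : closure Z = Z by exact: closed_closure.
apply: maxZ; last exact: subset_closure.
exact/irreducible_subsetP/irreducible_in_closure.
Qed.

Lemma locally_irreducibleP : locally_irreducible_space T <->
  forall x : T, exists U : set T, [/\ open U, U x & irreducible_in U].
Proof.
split=> irrT x; last first.
  have [U [Uo Ux irrU]] := irrT x.
  by exists U; [exact: open_nbhs_nbhs|exact/irreducible_subsetP].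
have [N + /irreducible_subsetP irrN] := irrT x.
rewrite nbhsE => -[U [Uo Ux] UN]; exists U; split=> //.
by apply: irreducible_in_open irrN Uo UN _; exists x.
Qed.

(** The part of [Z] in [U] is dense in [Z], so [Z] lies in the irreducible closure of [U], and
    maximality gives equality. Hence an irreducible open set meets at most one component. *)
Lemma irreducible_component_open Z U :
  irreducible_components T Z -> open U -> irreducible_in U ->
  Z `&` U !=set0 -> Z = closure U.
Proof.
move=> [/irreducible_subsetP irrZ maxZ] Uo irrU ZU; symmetry; apply: maxZ.
  exact/irreducible_subsetP/irreducible_in_closure.
apply: subset_trans (irreducible_in_sub_closure irrZ Uo ZU) _.
by apply: closureS; exact: subIsetr.
Qed.

Lemma locally_irreducible_components_finite :
  locally_irreducible_space T ->
  locally_finite_family (irreducible_components T).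
Proof.
move=> /locally_irreducibleP irrT x; have [U [Uo Ux irrU]] := irrT x.
exists U; first exact: open_nbhs_nbhs.
apply: sub_finite_set (finite_set1 (closure U)) => Z [compZ ZU].
exact: irreducible_component_open.
Qed.

Lemma irreducible_connected : irreducible_space T -> connected [set: T].
Proof.
move=> /irreducible_spaceP[_ irrT] B [b Bb] [U Uo BU] [C Cc BC].
apply/seteqP; split=> // x _; apply: contrapT => nBx.
(* A clopen set missing [x] would give two disjoint nonempty open sets, [U] and the complement of
   [C]. *)
have [|||y [_ []]] := irrT U (~` C) Uo; first exact: closed_openC.
- by exists b; move: Bb; rewrite BU.
- by exists x; split=> // Cx; apply: nBx; rewrite BC.
- by move: BU; rewrite BC !setTI => ->.
Qed.

Lemma irreducible_locally_irreducible :
  irreducible_space T -> locally_irreducible_space T.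
Proof.
move=> /irreducible_spaceP irrT x; exists setT; first exact: filterT.
exact/irreducible_subsetP.
Qed.

Lemma connected_locally_irreducible :
  [set: T] !=set0 -> connected [set: T] -> locally_irreducible_space T ->
  irreducible_space T.
Proof.
move=> [x _] connT /locally_irreducibleP irrT.
have [N [No Nx irrN]] := irrT x; apply/irreducible_spaceP.
suff <- : closure N = setT by exact: irreducible_in_closure.
apply: connT; first by exists x; exact: subset_closure.
- exists (closure N); last by rewrite setTI.
  rewrite openE => y clNy; have [M [Mo My irrM]] := irrT y.
  rewrite /interior nbhsE; exists M => //.
  (* Once [N] meets the irreducible open set [M], it is dense in it; so [M] lies in the closure of
     [N], which is therefore open. *)
  have MN : M `&` N !=set0.
    by rewrite setIC; apply: clNy; exact: open_nbhs_nbhs.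
  apply: subset_trans (irreducible_in_sub_closure irrM No MN) _.
  by apply: closureS; exact: subIsetr.
- by exists (closure N); [exact: closed_closure|rewrite setTI].
Qed.

(** A largest irreducible set through a point is a component, and the only one through that
    point. *)
Lemma locally_irreducible_of_component :
  (forall x : T, exists Z : set T, [/\ irreducible_in Z, Z x &
     forall Z' : set T, irreducible_in Z' -> Z' x -> Z' `<=` Z]) ->
  locally_finite_family (irreducible_components T) ->
  locally_irreducible_space T.
Proof.
move=> compT finT; apply/locally_irreducibleP => x.
have component y Z : irreducible_in Z -> Z y ->
    (forall Z' : set T, irreducible_in Z' -> Z' y -> Z' `<=` Z) ->
    irreducible_components T Z.
  move=> irrZ Zy maxZ; split=> [|Z' /irreducible_subsetP irrZ' ZZ'].
    exact/irreducible_subsetP.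
  by apply/seteqP; split=> //; apply: maxZ => //; exact: ZZ'.
have [Z [irrZ Zx maxZ]] := compT x.
have [N + finN] := finT x; rewrite nbhsE => -[M [Mo Mx] MN].
(* Only finitely many nearby components miss [x]; as they are closed, removing them leaves an open
   neighbourhood of [x]. *)
pose F := [set Z' | (irreducible_components T Z' /\ Z' `&` N !=set0) /\ ~ Z' x].
have finF : finite_set F by apply: sub_finite_set finN => Z' [].
pose U := M `&` \bigcap_(Z' in F) ~` Z'.
have Uo : open U.
  apply: openI => //; rewrite -setC_bigcup; apply: closed_openC.
  by apply: closed_bigcup => // Z' [[/irreducible_component_closed]].
have Ux : U x by split=> // Z' [_ nZ'x].
exists U; split=> //; apply: irreducible_in_open irrZ Uo _ _; last by exists x.
move=> y [My Fy]; have [Z' [irrZ' Z'y maxZ']] := compT y.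
suff Z'x : Z' x by exact: maxZ Z'y.
(* Were [x] outside [Z'], the component [Z'] would belong to [F], whose members avoid [y]. *)
apply: contrapT => nZ'x; apply: (Fy Z') => //; split=> //.
split; first exact: component maxZ'.
by exists y; split=> //; exact: MN.
Qed.

End Irreducible.

(** * Reduced irreducible rings are domains *)

Definition domain_ring (A : comPzRingType) : Prop :=
  (1 : A) <> 0 /\ forall a b : A, a * b = 0 -> a = 0 \/ b = 0.

Section PrimeIdeals.
Variable A : comPzRingType.
Implicit Types (a b f : A) (I : set A).

(** An ideal maximal among those that contain no power of [f] is prime; Zorn's lemma supplies
    one. *)
Lemma prime_avoiding_powers f :
  (forall n, f ^+ n <> 0) -> exists p : spec A, ~ p f.
Proof.
move=> fn0.
(* Membership of 0 is left out of [P], since the union of the empty chain must satisfy [P];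
   maximality recovers it. *)
pose P I := [/\ forall a b, I a -> I b -> I (a + b),
  forall a b, I b -> I (a * b) & forall n, ~ I (f ^+ n)].
have [|I [[ID IM If] maxI]] := @Zorn_bigcup A P.
  move=> F FP totF; split=> [a b [J FJ Ja] [K FK Kb]|a b [J FJ Jb]|n [J FJ Jf]].
  - have [JK|KJ] := totF _ _ FJ FK.
      by exists K => //; have [KD _ _] := FP _ FK; apply: KD => //; exact: JK.
    by exists J => //; have [JD _ _] := FP _ FJ; apply: JD => //; exact: KJ.
  - by exists J => //; have [_ JM _] := FP _ FJ; exact: JM.
  - by have [_ _ /(_ n)] := FP _ FJ.
have I0 : I 0.
  apply: contrapT => nI0; apply: (maxI (0 |` I)).
    by split=> [a Ia|/(_ 0 (or_introl erefl))//]; right.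
  split=> [a b [->|Ia] [->|Ib]|a b [->|Ib]|n [/fn0//|/If//]].
  - by left; rewrite addr0.
  - by rewrite add0r; right.
  - by rewrite addr0; right.
  - by right; exact: ID.
  - by left; rewrite mulr0.
  - by right; exact: IM.
(* By maximality the ideal generated by [I] and [a] contains a power of [f]. *)
have powI a : ~ I a -> exists n r, I (f ^+ n - r * a).
  move=> nIa; apply: contrapT => nf.
  apply: (maxI [set b | exists r, I (b - r * a)]).
    split=> [b Ib|Ja]; first by exists 0; rewrite mul0r subr0.
    by apply: nIa; apply: Ja; exists 1; rewrite mul1r subrr.
  split=> [b c [r br] [s cs]|b c [r cr]|n [r fr]].
  - exists (r + s); have -> : b + c - (r + s) * a = (b - r * a) + (c - s * a).
      by ring.
    exact: ID.
  - by exists (b * r); rewrite -mulrA -mulrBr; exact: IM.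
  - by apply: nf; exists n, r.
have primeI : prime_ideal I.
  split=> // [I1|a b Iab]; first by apply: (If 0); rewrite expr0.
  apply: contrapT => /not_orP[/powI[n [r Ir]] /powI[m [s Is]]].
  apply: (If (n + m)%N).
  (* Modulo [I] the two powers are [r * a] and [s * b], so their product is a multiple of
     [a * b]. *)
  have -> : f ^+ (n + m) = f ^+ m * (f ^+ n - r * a) +
      (r * a * (f ^+ m - s * b) + r * s * (a * b)) by rewrite exprD; ring.
  apply: (ID); first exact: IM.
  apply: (ID); exact: IM.
by exists (SpecPoint primeI) => /= fI; apply: (If 1); rewrite expr1.
Qed.

Lemma nilpotent_in_all_primes f :
  (forall p : spec A, p f) -> exists n, f ^+ n = 0.
Proof.
move=> pf; apply: contrapT => /forallNP fn.
by have [p] := prime_avoiding_powers fn; apply; exact: pf.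
Qed.

Lemma open_basic f : open [set p : spec A | ~ p f].
Proof.
exists [set f]; apply/seteqP; split=> p /=; first by move=> npf /(_ f erefl).
by move=> npf pf; apply: npf => _ ->.
Qed.

Definition basic_opens f : opens (spec A) := Opens (open_basic f).

Lemma open_basicP (U : set (spec A)) (p : spec A) : open U -> U p ->
  exists f, ~ p f /\ basic_opens f `<=` U.
Proof.
move=> [E ->] /existsNP[f /not_implyP[Ef npf]].
by exists f; split=> // q nqf /(_ f Ef).
Qed.

(** Nonzero elements of a reduced ring are not nilpotent, so their basic open sets are nonempty and
    share a prime; it contains the product 0 but neither factor. *)
Lemma domain_of_irreducible :
  reduced_ring A -> irreducible_ring A -> domain_ring A.
Proof.
move=> redA /irreducible_spaceP[[p _] irrA].
split=> [A10|a b ab0].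
  by have [[p0 _ _] np1 _] := spec_prime p; apply: np1; rewrite A10.
apply: contrapT => /not_orP[a0 b0].
have basic0 c : c <> 0 -> [set: spec A] `&` basic_opens c !=set0.
  move=> c0; apply: contrapT => /forallNP nc.
  have [|n /redA//] := @nilpotent_in_all_primes c.
  by move=> q; apply: contrapT => nqc; apply: (nc q).
have [q [_ [qa qb]]] :=
  irrA _ _ (open_basic a) (open_basic b) (basic0 _ a0) (basic0 _ b0).
have [[q0 _ _] _ qM] := spec_prime q.
by case: (qM a b) => //; rewrite ab0.
Qed.

(** The zero ideal is a point that lies in every nonempty open set. *)
Lemma irreducible_of_domain : domain_ring A -> irreducible_ring A.
Proof.
move=> [A10 A0]; apply/irreducible_spaceP.
have prime0 : prime_ideal [set 0 : A].
  split=> //; split=> // [a b -> ->|a b ->]; first exact: addr0.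
  exact: mulr0.
pose p0 := SpecPoint prime0.
have p0U (U : set (spec A)) : open U -> [set: spec A] `&` U !=set0 -> U p0.
  move=> Uo [p [_ Up]]; have [f [npf fU]] := open_basicP Uo Up.
  apply: fU => /= f0; apply: npf; rewrite f0.
  by have [[]] := spec_prime p.
split=> [|U V Uo Vo /(p0U _ Uo) Up0 /(p0U _ Vo) Vp0]; exists p0 => //.
Qed.

End PrimeIdeals.

(** * Stalks in affine charts *)

(** An affine open piece of [X], given as an open embedding of a spectrum with a comparison of
    sections; mapping out of the spectrum avoids points of a subtype. *)
Record affine_chart (X : presheafed_space) : Type := AffineChart {
  chart_ring : comPzRingType;
  chart_map :> spec chart_ring -> X;
  chart_continuous : continuous chart_map;
  chart_inj : injective chart_map;
  chart_opens : opens (spec chart_ring) -> opens X;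
  chart_opensE : forall V, chart_opens V = chart_map @` V :> set X;
  chart_sec : forall V : opens (spec chart_ring),
    {rmorphism spec_section V -> sections (chart_opens V)};
  chart_sec_bij : forall V, bijective (chart_sec V);
  chart_sec_natural : forall (V W : opens (spec chart_ring)) (WV : W `<=` V)
    (WV' : chart_opens W `<=` chart_opens V) (s : spec_section V),
    chart_sec W (ss_restr WV s) = restr WV' (chart_sec V s)
}.

Arguments chart_opens {X} a V.
Arguments chart_opensE {X} a V.
Arguments chart_sec {X} a V.
Arguments chart_sec_bij {X} a V.
Arguments chart_sec_natural {X} a {V W}.

(** The chart inverts the homeomorphism from an affine neighbourhood to its spectrum, then includes
    the neighbourhood in [X]. *)
Lemma affine_chart_exists (X : scheme) (x : X) :
  exists (c : affine_chart X) (p : spec (chart_ring c)), c p = x.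
Proof.
have [U [Ux [A [m [[g [gc mK gK]] mb]]]]] := scheme_affine x.
pose V0 (V : opens (spec A)) : opens X :=
  opens_image (opens_preimage (@mor_continuous _ _ m) V).
have gval_cont : continuous (fun p => set_val (g p) : X).
  by move=> p; apply: continuous_comp; [exact: gc|exact: initial_continuous].
have gval_inj : injective (fun p => set_val (g p) : X).
  by move=> p q /val_inj; exact: can_inj gK _ _.
have V0E V : V0 V = (fun p => set_val (g p)) @` V :> set X.
  apply/seteqP; split=> [_ [y /= Vy <-]|_ [p Vp <-]].
    by exists (m y) => //; rewrite mK.
  by exists (g p) => //=; rewrite gK.
have nat0 (V W : opens (spec A)) (WV : W `<=` V) (WV' : V0 W `<=` V0 V)
    (s : spec_section V) :
    mor_sharp m W (ss_restr WV s) = restr WV' (mor_sharp m V s).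
  by have /= -> := mor_natural m WV s; exact: restr_irr.
exists (@AffineChart X A _ gval_cont gval_inj V0 V0E
  (fun V => mor_sharp m V) mb nat0).
by exists (m (SigSub (mem_set Ux))) => /=; rewrite mK.
Qed.

Section Chart.
Variables (X : presheafed_space) (c : affine_chart X).
Local Notation A := (chart_ring c).
Implicit Types (V W : opens (spec A)) (p q : spec A).

Lemma chart_opensP V p : chart_opens c V (c p) <-> V p.
Proof.
have /(congr1 (@^~ (c p))) /= -> := chart_opensE c V.
by split=> [[q Vq /chart_inj <-]//|Vp]; exists p.
Qed.

Lemma chart_opensS V W : W `<=` V -> chart_opens c W `<=` chart_opens c V.
Proof. by rewrite !chart_opensE; exact: image_subset. Qed.

Lemma chart_opensW V (U : opens X) :
  V `<=` [set p | U (c p)] -> chart_opens c V `<=` U.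
Proof. by move=> VU; rewrite chart_opensE => _ [p Vp <-]; exact: VU. Qed.

Definition chart_preimage (U : opens X) : opens (spec A) :=
  opens_preimage (@chart_continuous X c) U.

Lemma chart_preimage_sub (U : opens X) :
  chart_opens c (chart_preimage U) `<=` U.
Proof. exact: chart_opensW. Qed.

End Chart.

Section Germs.
Variables (X : presheafed_space) (x : X).

Lemma germ_ind (P : stalk x -> Prop) :
  (forall (U : opens X) (Ux : U x) (s : sections U), P (germ Ux s)) ->
  forall sigma, P sigma.
Proof. by move=> Pgerm; apply: quot_ind => -[U Ux s]; exact: Pgerm. Qed.

Lemma germ_eqP (U V : opens X) (Ux : U x) (Vx : V x) s t :
  germ Ux s = germ Vx t <-> exists W : opens X, W x /\
    exists (WU : W `<=` U) (WV : W `<=` V), restr WU s = restr WV t.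
Proof. exact: quot_piP. Qed.

Lemma germ_restr (U V : opens X) (Ux : U x) (Vx : V x) (VU : V `<=` U) s :
  germ Vx (restr VU s) = germ Ux s.
Proof.
apply/germ_eqP; exists V; split=> //; exists (fun _ => id), VU.
exact: restr_id.
Qed.

Lemma germM (U : opens X) (Ux : U x) (s t : sections U) :
  germ Ux (s * t) = germ Ux s * germ Ux t.
Proof.
rewrite [RHS]quot_pi_mul; apply/germ_eqP; exists U; split=> //.
have UUU : U `<=` opensI U U by move=> y Uy; split.
exists (fun _ => id), UUU => /=.
rewrite !rmorphM !restr_trans; congr (_ * _); exact: restr_irr.
Qed.

Lemma germ0 (U : opens X) (Ux : U x) : germ Ux 0 = 0.
Proof.
apply/germ_eqP; exists U; split=> //; exists (fun _ => id), (fun _ _ => I).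
by rewrite !rmorph0.
Qed.

Lemma germ1 (U : opens X) (Ux : U x) : germ Ux 1 = 1.
Proof.
apply/germ_eqP; exists U; split=> //; exists (fun _ => id), (fun _ _ => I).
by rewrite !rmorph1.
Qed.

Lemma germD (U : opens X) (Ux : U x) (s t : sections U) :
  germ Ux (s + t) = germ Ux s + germ Ux t.
Proof.
rewrite [RHS]quot_pi_add; apply/germ_eqP; exists U; split=> //.
have UUU : U `<=` opensI U U by move=> y Uy; split.
exists (fun _ => id), UUU => /=.
rewrite !rmorphD !restr_trans; congr (_ + _); exact: restr_irr.
Qed.

End Germs.

Lemma to_frac_eqP (A : comPzRingType) (p : spec A) a f (pf : ~ p f) b g
    (pg : ~ p g) :
  to_frac a pf = to_frac b pg <-> exists2 h, ~ p h & h * (a * g) = h * (b * f).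
Proof. exact: quot_piP. Qed.

(* The stalk at c p, seen as the localization of the chart ring at p. *)
Section ChartStalk.
Variables (X : presheafed_space) (c : affine_chart X) (p : spec (chart_ring c)).
Local Notation A := (chart_ring c).
Implicit Types (V W : opens (spec A)) (a b f g h : A).

Definition chart_germ V (Vp : V p) (s : spec_section V) : stalk (c p) :=
  germ (proj2 (chart_opensP V p) Vp) (chart_sec c V s).

Lemma chart_germM V (Vp : V p) s t :
  chart_germ Vp (s * t) = chart_germ Vp s * chart_germ Vp t.
Proof. by rewrite /chart_germ rmorphM germM. Qed.

Lemma chart_germ_restr V W (Vp : V p) (Wp : W p) (WV : W `<=` V) s :
  chart_germ Wp (ss_restr WV s) = chart_germ Vp s.
Proof.
rewrite /chart_germ (chart_sec_natural c WV (chart_opensS WV)).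
exact: germ_restr.
Qed.

(** The germ vanishes on an open set of [X]; pulled back to the spectrum, vanishing passes to [s]
    because [chart_sec] is injective. *)
Lemma chart_germ_eq0 V (Vp : V p) s : chart_germ Vp s = 0 ->
  exists W : opens (spec A), W p /\ exists WV : W `<=` V, ss_restr WV s = 0.
Proof.
rewrite /chart_germ -(germ0 (U := opensT X) I) => /germ_eqP[U [Up [UV [UT]]]].
rewrite rmorph0 => s0; have WV : chart_preimage c U `<=` V.
  by move=> q /= /UV /chart_opensP.
exists (chart_preimage c U); split=> //; exists WV.
apply: (bij_inj (chart_sec_bij c _)); rewrite rmorph0.
rewrite (chart_sec_natural c WV (chart_opensS WV)).
rewrite (restr_irr _ (subset_trans (@chart_preimage_sub _ c U) UV)).
by rewrite -restr_trans s0 rmorph0.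
Qed.

(** Restrict a representative to the part of its domain inside the chart and invert [chart_sec]. *)
Lemma chart_germP (sigma : stalk (c p)) :
  exists V (Vp : V p) (s : spec_section V), sigma = chart_germ Vp s.
Proof.
elim/germ_ind: sigma => U Up tau.
have Vp : chart_preimage c U p by [].
have [inv _ secK] := chart_sec_bij c (chart_preimage c U).
exists (chart_preimage c U), Vp.
exists (inv (restr (@chart_preimage_sub _ c U) tau)).
by rewrite /chart_germ secK; symmetry; exact: germ_restr.
Qed.

Definition scalar_section V a : spec_section V :=
  SpecSection (@ss_const_fraction A V a).

Definition scalar_germ a : stalk (c p) :=
  @chart_germ (opensT (spec A)) I (scalar_section _ a).

Lemma scalar_sectionM V a b :
  scalar_section V (a * b) = scalar_section V a * scalar_section V b.
Proof.
apply: ss_ext => q Vq /=; rewrite to_fracM; apply/to_frac_eqP.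
by exists 1; [exact: spec_compl1|ring].
Qed.

Lemma scalar_germE V (Vp : V p) a :
  scalar_germ a = chart_germ Vp (scalar_section V a).
Proof.
have VT : V `<=` opensT (spec A) by [].
rewrite /scalar_germ -(chart_germ_restr _ Vp VT); congr chart_germ.
exact: ss_ext.
Qed.

Lemma scalar_germM a b : scalar_germ (a * b) = scalar_germ a * scalar_germ b.
Proof. by rewrite /scalar_germ scalar_sectionM chart_germM. Qed.

Lemma scalar_germD a b : scalar_germ (a + b) = scalar_germ a + scalar_germ b.
Proof.
rewrite /scalar_germ /chart_germ -germD -rmorphD.
congr (germ _ (chart_sec _ _ _)).
apply: ss_ext => q Vq /=; rewrite to_fracD; apply/to_frac_eqP.
by exists 1; [exact: spec_compl1|ring].
Qed.

Lemma scalar_germ1 : scalar_germ 1 = 1.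
Proof.
rewrite -(germ1 (proj2 (chart_opensP (opensT (spec A)) p) I)).
by rewrite -(rmorph1 (chart_sec c _)).
Qed.

Lemma scalar_germX a n : scalar_germ (a ^+ n) = scalar_germ a ^+ n.
Proof.
elim: n => [|n IHn]; first by rewrite !expr0 scalar_germ1.
by rewrite !exprS scalar_germM IHn.
Qed.

(** Evaluation at [p] gives [h]; conversely, one such [h] kills [a] at every point of its basic open
    set. *)
Lemma scalar_germ_eq0 a :
  scalar_germ a = 0 <-> exists2 h, ~ p h & h * a = 0.
Proof.
split=> [/chart_germ_eq0[W [Wp [WT a0]]]|[h nph ha0]].
  have /= := congr1 (fun s : spec_section W => s p Wp) a0.
  move=> /to_frac_eqP[h nph ha]; exists h => //.
  by move: ha; rewrite mulr1 mul0r mulr0.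
have hp : basic_opens h p by [].
rewrite (scalar_germE hp) /chart_germ -(germ0 (proj2 (chart_opensP _ p) hp)).
rewrite -(rmorph0 (chart_sec c _)); congr (germ _ (chart_sec _ _ _)).
apply: ss_ext => q nqh; apply/to_frac_eqP; exists h => //.
by rewrite mulr1 mul0r mulr0.
Qed.

(** The function [1 / f] is a section over the basic open set of [f], a neighbourhood of [p]. *)
Lemma scalar_germ_unit f : ~ p f -> exists u, u * scalar_germ f = 1.
Proof.
move=> npf; pose V := basic_opens f; have Vp : V p by [].
have inv_fraction : locally_fraction (fun q (Vq : V q) => to_frac 1 Vq).
  move=> q Vq; exists V; split=> //; exists 1, f => r Vr _.
  by exists Vr.
exists (chart_germ Vp (SpecSection inv_fraction)).
rewrite (scalar_germE Vp) -chart_germM -scalar_germ1 (scalar_germE Vp).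
congr chart_germ; apply: ss_ext => q Vq /=; rewrite to_fracM.
by apply/to_frac_eqP; exists 1; [exact: spec_compl1|ring].
Qed.

Lemma scalar_germ_fraction (sigma : stalk (c p)) :
  exists a f, ~ p f /\ sigma * scalar_germ f = scalar_germ a.
Proof.
have [V [Vp [s ->]]] := chart_germP sigma.
have [W [Wp WV [a [f sE]]]] := ss_fraction s Vp.
exists a, f; split; first by have [] := sE p Vp Wp.
rewrite -(chart_germ_restr Vp Wp WV) !(scalar_germE Wp) -chart_germM.
congr chart_germ; apply: ss_ext => q Wq /=.
have [fq ->] := sE q (WV q Wq) Wq; rewrite to_fracM.
by apply/to_frac_eqP; exists 1; [exact: spec_compl1|ring].
Qed.

Lemma scalar_germ_inj_mul f sigma :
  ~ p f -> sigma * scalar_germ f = 0 -> sigma = 0.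
Proof.
move=> /scalar_germ_unit[u uf] sf.
by rewrite -[sigma]mulr1 -uf mulrCA sf mulr0.
Qed.

End ChartStalk.

(** * Integral schemes *)

Lemma domain_stalk_of_irreducible (X : scheme) (x : X) (N : opens X) :
  reduced X -> N x -> irreducible_in (N : set X) -> domain_ring (stalk x).
Proof.
have [c [p <-]] := affine_chart_exists x => redX Nx [_ irrN].
split=> [|sigma tau st0].
  rewrite -(scalar_germ1 p) => /scalar_germ_eq0[h nph].
  rewrite mulr1 => h0; apply: nph; rewrite h0.
  by have [[]] := spec_prime p.
have [a [f [npf sa]]] := scalar_germ_fraction sigma.
have [b [g [npg tb]]] := scalar_germ_fraction tau.
have /scalar_germ_eq0[h nph hab] : scalar_germ p (a * b) = 0.
  by rewrite scalar_germM -sa -tb mulrACA st0 mul0r.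
have [k [npk kN]] := open_basicP (opens_open (chart_preimage c N)) Nx.
have npkh := spec_complM npk nph.
(* Besides [d], neither [k] nor [h] vanishes on [D d]: [k] keeps the locus in [N], and [h] forces
   [a * b] to vanish there. *)
pose D d := basic_opens (d * (k * h)).
(* If [D d] is empty, [d * (k * h)] is nilpotent; as [k * h] lies outside [p], the germ of [d] is
   nilpotent, hence zero by reducedness. *)
have nilD (d e : chart_ring c) rho : ~ p e ->
    rho * scalar_germ p e = scalar_germ p d -> ~ ((D d : set _) !=set0) ->
    rho = 0.
  move=> npe rd nD; apply: (scalar_germ_inj_mul npe); rewrite rd.
  have [|n dn] := @nilpotent_in_all_primes _ (d * (k * h)).
    by move=> q; apply: contrapT => nq; apply: nD; exists q.
  apply: (redX _ _ n); rewrite -scalar_germX.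
  apply/scalar_germ_eq0; exists ((k * h) ^+ n); last by rewrite -exprMn mulrC.
  elim: n {dn} => [|n IHn]; first by rewrite expr0; exact: spec_compl1.
  by rewrite exprS; exact: spec_complM.
apply: contrapT => /not_orP[s0 t0].
have meetD d : (D d : set _) !=set0 ->
    (N : set X) `&` chart_opens c (D d) !=set0.
  move=> [q Dq]; exists (c q); split; last exact/chart_opensP.
  apply: (kN q) => /= qk; apply: Dq.
  have [[_ _ qM] _ _] := spec_prime q.
  by rewrite mulrCA mulrC; exact: qM.
have [||y [_ [Da Db]]] := irrN _ _ (opens_open (chart_opens c (D a)))
  (opens_open (chart_opens c (D b))).
- by apply: meetD; apply: contrapT => /(nilD _ _ _ npf sa).
- by apply: meetD; apply: contrapT => /(nilD _ _ _ npg tb).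
move: Da; rewrite chart_opensE => -[q Da cq].
move: Db; rewrite -cq => /chart_opensP/(spec_complM Da); apply.
(* An element that should lie outside [q] is a multiple of [h * (a * b)], which is 0. *)
have -> : a * (k * h) * (b * (k * h)) = k * (k * h) * (h * (a * b)) by ring.
by rewrite hab mulr0; have [[]] := spec_prime q.
Qed.

Lemma generic_point_of_domain_stalk (X : scheme) (x : X) :
  domain_ring (stalk x) -> exists y : X, closure [set y] x /\
    forall Z : set X, irreducible_in Z -> Z x -> Z `<=` closure [set y].
Proof.
have [c [p <-]] := affine_chart_exists x => -[dom1 dom].
have prime_ker : prime_ideal [set a | scalar_germ p a = 0].
  split=> [|/=|a b /=]; last by rewrite scalar_germM => /dom.
    split=> [|a b /= a0 b0|a b /= b0].
    - by apply/scalar_germ_eq0; exists 1; [exact: spec_compl1|rewrite mulr0].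
    - by rewrite scalar_germD a0 b0 addr0.
    - by rewrite scalar_germM b0 mulr0.
  by rewrite scalar_germ1.
pose eta := SpecPoint prime_ker; exists (c eta).
(* The second premise says that [eta] is contained in [q]; an open set around a prime contains all
   smaller primes. *)
have mem_eta (U : opens X) (q : spec (chart_ring c)) : U (c q) ->
    (forall b, ~ q b -> ~ eta b) -> U (c eta).
  move=> Uq qeta.
  have [b [nqb bU]] := open_basicP (opens_open (chart_preimage c U)) Uq.
  exact: (bU eta (qeta _ nqb)).
split=> [B|Z [_ irrZ] Zx z Zz B]; rewrite nbhsE => -[U [Uo Uz] UB].
  exists (c eta); split=> //; apply: UB; apply: (mem_eta (Opens Uo) p Uz).
  move=> b npb /scalar_germ_eq0[h nph hb0].
  have : ~ p (h * b) by exact: spec_complM.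
  by apply; rewrite hb0; have [[]] := spec_prime p.
exists (c eta); split=> //; apply: UB.
(* The point [z] may lie outside the chart; irreducibility replaces it by a point [z'] of [Z] in
   both [U] and the chart. *)
have [||z' [Zz' [Uz' /=]]] :=
  irrZ U (chart_opens c (opensT _)) Uo (opens_open _).
- by exists z.
- by exists (c p); split=> //; exact/chart_opensP.
rewrite chart_opensE => -[q _ qz']; rewrite -{z'}qz' in Zz' Uz'.
apply: (mem_eta (Opens Uo) q Uz') => b nqb /scalar_germ_eq0[h nph hb0].
(* If [eta] were not contained in [q], the basic open sets of [h] around [p] and of [b] around [q]
   would meet inside [Z], at a prime avoiding [h] and [b] although [h * b] is 0. *)
have [||w [_ []]] := irrZ _ _ (opens_open (chart_opens c (basic_opens h)))
  (opens_open (chart_opens c (basic_opens b))).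
- by exists (c p); split=> //; exact/chart_opensP.
- by exists (c q); split=> //; exact/chart_opensP.
rewrite chart_opensE => -[r nrh <-] /chart_opensP /= nrb.
have : ~ r (h * b) by exact: spec_complM.
by apply; rewrite hb0; have [[]] := spec_prime r.
Qed.

Lemma locally_integralP (X : scheme) : locally_integral X <->
  pointwise_integral X /\ locally_finite_family (irreducible_components X).
Proof.
split=> [[redX irrX]|[[redX irrX] finX]].
  split; last exact: locally_irreducible_components_finite.
  split=> // x; apply: irreducible_of_domain.
  have [U [Uo Ux irrU]] := proj1 (@locally_irreducibleP X) irrX x.
  exact: (@domain_stalk_of_irreducible X x (Opens Uo)).
split=> //; apply: locally_irreducible_of_component => // x.
have [|y [yx maxy]] := @generic_point_of_domain_stalk X x.
  exact/domain_of_irreducible/irrX.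
exists (closure [set y]); split=> //.
exact/irreducible_in_closure/irreducible_in_set1.
Qed.

Lemma integralP (X : scheme) : integral X <->
  [set: X] !=set0 /\ connected [set: X] /\ locally_integral X.
Proof.
split=> [[redX irrX]|[X0 [connX [redX irrX]]]]; last first.
  by split=> //; exact: connected_locally_irreducible.
split; first by have [] := proj1 (@irreducible_spaceP X) irrX.
split; first exact: irreducible_connected.
by split=> //; exact: irreducible_locally_irreducible.
Qed.

Theorem mainTheorem11 (X : scheme) :
  (locally_integral X <->
   pointwise_integral X /\ locally_finite_family (irreducible_components X)) /\
  ((integral X <->
    [set: X] !=set0 /\ connected [set: X] /\ locally_integral X) /\
   (integral X <->
    [set: X] !=set0 /\ connected [set: X] /\ pointwise_integral X /\
    locally_finite_family (irreducible_components X))).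
Proof.
split; first exact: locally_integralP.
split; first exact: integralP.
(* The last equivalence is the previous one with local integrality replaced through the first
   part. *)
by rewrite -locally_integralP; exact: integralP.
Qed.
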